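(* Let $V$ be a real locally convex space with topological dual $V'$, and let $V_* \subseteq V'$ be a separating linear subspace. Let (a) $\Lambda : V_* \times V_* \to \mathbb{R}$ be a skew-symmetric bilinear map such that for every $\alpha \in V_*$ there exists an element $\alpha^\sharp \in V$ with $\Lambda(\beta,\alpha) = \beta(\alpha^\sharp)$ for every $\beta \in V_*$; and (b) $[\cdot,\cdot]_0$ be a Lie bracket on $V_*$ such that (i) $\Lambda$ is a $2$-cocycle, i.e. $\Lambda([\alpha,\beta]_0,\gamma) + \Lambda([\beta,\gamma]_0,\alpha) + \Lambda([\gamma,\alpha]_0,\beta) = 0$ for all $\alpha,\beta,\gamma \in V_*$; (ii) for every $\alpha\in V_*$ the linear map $\mathrm{ad}_0\alpha : V_* \to V_*$, $\beta \mapsto [\alpha,\beta]_0$, has a continuous adjoint map $\mathrm{ad}_0^*\alpha : V \to V$, defined by $\beta(\mathrm{ad}_0^*\alpha\, v) = [\alpha,\beta]_0(v)$ for $\beta \in V_*$, $v \in V$. These data lead to a Lie algebra structure on the space $\hat V_* := \mathbb{R}1 \oplus V_*$ of affine functions on $V$, given by $$[t+\alpha, s+\beta] := \Lambda(\alpha,\beta) + [\alpha,\beta]_0 \qquad (t,s\in\mathbb{R},\ \alpha,\beta\in V_* ).$$ Let $\mathcal{A} \subseteq C^\infty(V)$ be the unital subalgebra generated by $V_*$ (so $\mathcal{A} \cong S(V_* )$, the symmetric algebra over $V_*$). Then $\mathrm{d}F(v) \in V_*$ for all $F \in \mathcal{A}$ and $v \in V$, and $$\{F,G\}(v) := \langle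 [\mathrm{d}F(v),\mathrm{d}G(v)], v\rangle \qquad (v \in V,\ F,G \in \mathcal{A})$$ defines a weak Poisson structure on $V$. Here $[\mathrm{d}F(v),\mathrm{d}G(v)] \in \hat V_*$ is the bracket of $\hat V_*$ and $\langle f, v\rangle = f(v)$ is evaluation of the affine function $f\in\hat V_*$ at $v$; that is, $\{F,G\}(v) = \Lambda(\mathrm{d}F(v),\mathrm{d}G(v)) + [\mathrm{d}F(v),\mathrm{d}G(v)]_0(v)$.
   Context: All topological vector spaces are Hausdorff and real. A linear subspace $V_*\subseteq V'$ is called separating if $\alpha(v)=0$ for all $\alpha\in V_*$ implies $v=0$. Smoothness between open subsets of locally convex spaces: $f:U\subseteq E\to F$ is $C^k$ ($k\in\mathbb{N}\cup\{\infty\}$) if it is continuous, all iterated directional derivatives $\mathrm{d}^jf(x)(h_1,\dots,h_j)=(\partial_{h_j}\cdots\partial_{h_1}f)(x)$, $1\le j\le k$, exist for all $x \in U$, $h_1,\dots,h_j\in E$, and the maps $\mathrm{d}^jf:U\times E^j\to F$ are continuous; smooth means $C^\infty$. Smooth manifolds modeled on locally convex spaces, tangent bundles and the Lie algebra $\mathcal{V}(M)$ of smooth vector fields are defined as in finite dimensions; $C^\infty(M)=C^\infty(M,\mathbb{R})$. A weak Poisson structure on a smooth manifold $M$ modeled on a locally convex space is a unital subalgebra $\mathcal{A}\subseteq C^\infty(M)$ (containing constants, closed under pointwise multiplication) such that: (P1) $\mathcal{A}$ is endowed with a Poisson bracket $\{\cdot,\cdot\}:\mathcal{A}\times\mathcal{A}\to\mathcal{A}$,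 i.e. a (bilinear) Lie bracket satisfying the Leibniz rule $\{F,GH\}=\{F,G\}H+G\{F,H\}$; (P2) if $m\in M$ and $v\in T_m(M)$ satisfy $\mathrm{d}F(m)v=0$ for every $F\in\mathcal{A}$, then $v=0$; (P3) for every $H\in\mathcal{A}$ there exists a smooth vector field $X_H\in\mathcal{V}(M)$ with $X_HF=\{F,H\}$ for all $F\in\mathcal{A}$. The triple $(M,\mathcal{A},\{\cdot,\cdot\})$ is then called a weak Poisson manifold. *)

(* Defs.v *)
From HB Require Import structures.
From mathcomp Require Import all_boot all_order all_algebra.
From mathcomp Require Import all_classical all_reals all_analysis.

Set Implicit Arguments.
Unset Strict Implicit.
Unset Printing Implicit Defensive.
Import Order.TTheory GRing.Theory Num.Theory.
Import numFieldNormedType.Exports.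

Local Open Scope classical_set_scope.
Local Open Scope ring_scope.

(* Algebraic structures carried by a subset S of an ambient lmodType: an
   operation on S is a total function on the ambient type, of which only the
   values at arguments in S are used. *)
Section Algebra.
Context {R : realType}.

Definition linear_on (W Z : lmodType R) (S : set W) (f : W -> Z) : Prop :=
  forall (a : R) (x y : W), S x -> S y -> f (a *: x + y) = a *: f x + f y.

Definition bilinear_on (W Z : lmodType R) (S : set W) (b : W -> W -> Z) : Prop :=
  (forall x, S x -> linear_on S (b x)) /\
  (forall y, S y -> linear_on S (b ^~ y)).

Record lie_bracket_on (W : lmodType R) (S : set W) (br : W -> W -> W) : Prop := {
  lie_closed : forall x y, S x -> S y -> S (br x y) ;
  lie_bilinear : bilinear_on S br ;
  lie_alternating : forall x, S x -> br x x = 0 ;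
  lie_jacobi : forall x y z, S x -> S y -> S z ->
    br (br x y) z + br (br y z) x + br (br z x) y = 0 }.

Context {T : Type}.

Definition unital_subalgebra (A : set (T -> R^o)) : Prop :=
  submod_closed (mem A) /\ mulr_closed (mem A).

Definition algebra_morphism_on (A : set (T -> R^o)) (B : comAlgType R)
    (f : (T -> R^o) -> B) : Prop :=
  [/\ linear_on A f, f 1 = 1 &
      forall F G, A F -> A G -> f (F * G) = f F * f G].

(* Universal property of the symmetric algebra S(W), with W `<=` A. *)
Definition is_symmetric_algebra (W A : set (T -> R^o)) : Prop :=
  W `<=` A /\
  forall (B : comAlgType R) (phi : (T -> R^o) -> B), linear_on W phi ->
    exists Phi : (T -> R^o) -> B,
      [/\ algebra_morphism_on A Phi,
          forall w, W w -> Phi w = phi w &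
          forall Psi : (T -> R^o) -> B,
            algebra_morphism_on A Psi -> (forall w, W w -> Psi w = phi w) ->
            forall F, A F -> Psi F = Phi F].

End Algebra.

(* The library's derivable and derive require normed modules, and lim requires
   a pointed codomain, so the directional derivative is redefined here for
   locally convex spaces; the default value 0 is returned when the limit does
   not exist. *)
Section Smooth.
Context {R : realType} {E F : tvsType R}.

Definition is_dderive (f : E -> F) (x h : E) (l : F) : Prop :=
  (fun t : R => t^-1 *: (f (x + t *: h) - f x)) @ 0^' --> l.

Definition dderivable (f : E -> F) (x h : E) : Prop :=
  exists l, is_dderive f x h l.

Definition dderive (f : E -> F) (x h : E) : F := xget 0 (is_dderive f x h).

(* iter_dderive f [:: h1; ...; hj] x = (d_{hj} ... d_{h1} f)(x) *)
Definition iter_dderive (f : E -> F) (hs : seq E) : E -> F :=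
  foldl (fun g h x => dderive g x h) f hs.

(* d^j f : E x E^j -> F *)
Definition diffn (f : E -> F) (j : nat) (p : E * 'rV[E]_j) : F :=
  iter_dderive f [seq p.2 0 i | i <- enum 'I_j] p.1.

(* C^oo maps on the whole of E; the case j = 0 of the second clause is the
   continuity of f. *)
Definition smooth (f : E -> F) : Prop :=
  (forall (hs : seq E) (h x : E), dderivable (iter_dderive f hs) x h) /\
  (forall j : nat, continuous (@diffn f j)).

End Smooth.

Section WeakPoisson.
Context {R : realType} {V : tvsType R}.

Definition topological_dual : set (V -> R^o) :=
  [set alpha | linear alpha /\ continuous alpha].

Definition separating (W : set (V -> R^o)) : Prop :=
  forall v : V, (forall alpha, W alpha -> alpha v = 0) -> v = 0.

(* Weak Poisson structures on the manifold V, with its single chart id : tangent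
   spaces are identified with V, the differential of F at v is dderive F v,
   and vector fields are smooth maps X : V -> V, acting on functions by
   (X F)(v) = dF(v)(X v). *)
Record weak_poisson (A : set (V -> R^o))
    (br : (V -> R^o) -> (V -> R^o) -> (V -> R^o)) : Prop := {
  wp_smooth : forall F, A F -> smooth F ;
  wp_subalgebra : unital_subalgebra A ;
  wp_lie : lie_bracket_on A br ;
  wp_leibniz : forall F G H, A F -> A G -> A H ->
    br F (G * H) = br F G * H + G * br F H ;
  wp_separating : forall m v : V,
    (forall F, A F -> dderive F m v = 0) -> v = 0 ;
  wp_hamiltonian : forall H, A H -> exists2 X : V -> V, smooth X &
    forall F, A F -> forall m, dderive F m (X m) = br F H m }.

Variables (Vstar : set (V -> R^o)) (Lambda : (V -> R^o) -> (V -> R^o) -> R^o)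
  (br0 : (V -> R^o) -> (V -> R^o) -> (V -> R^o)).

Definition affine_functions : set (V -> R^o) :=
  [set f | exists t : R, exists2 alpha, Vstar alpha & f = cst t + alpha].

Definition linear_part (f : V -> R^o) : V -> R^o := f - cst (f 0).

Definition affine_bracket (f g : V -> R^o) : V -> R^o :=
  cst (Lambda (linear_part f) (linear_part g)) +
  br0 (linear_part f) (linear_part g).

Definition generated_subalgebra : set (V -> R^o) :=
  smallest unital_subalgebra Vstar.

Definition poisson_bracket (F G : V -> R^o) : V -> R^o :=
  fun v => affine_bracket (dderive F v) (dderive G v) v.

End WeakPoisson.
Arguments topological_dual {R} V.

(* Main.v *)
Require Import Defs.
From HB Require Import structures.
From mathcomp Require Import all_boot all_order all_algebra.
From mathcomp Require Import all_classical all_reals all_analysis.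
From mathcomp Require Import ring.
Set Implicit Arguments.
Unset Strict Implicit.
Unset Printing Implicit Defensive.
Import Order.TTheory GRing.Theory Num.Theory.
Import numFieldNormedType.Exports.
Local Open Scope classical_set_scope.
Local Open Scope ring_scope.

(** Every [F] in the algebra [A] generated by the space [W] of functionals is a
    polynomial in elements of [W]. All properties are proved for [A] by checking
    them on generators and on sums and products
    ([generated_subalgebra_ind]).

    _Smoothness._ Polynomial maps built from continuous linear maps, sums and
    products by scalars are continuous and closed under directional derivatives
    ([poly_map_derive]), hence smooth ([poly_map_smooth]). This applies to the
    elements of [A] and to the Hamiltonian vector fields. The differential of
    [F] at a point is a linear combination of elements of [W]
    ([generated_differentiable], [dderive_generated]).

    _Symmetric algebra._ A linear map [phi] from [W] to a commutative algebra [B]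
    extends to [A] by evaluating polynomial expressions at [phi], provided that
    an expression which vanishes as a function on [V] also vanishes at [phi]
    ([polyfun_vanish]). On finitely many functionals, [phi] is a combination with
    coefficients in [B] of evaluations at points of [V]
    ([finite_interpolation]). For real coefficients such a combination is itself
    the evaluation at a point; the real coefficients are replaced by elements of
    [B] one at a time, because a polynomial over [B] which vanishes at all
    natural numbers is zero ([poly_eventually_zero]).

    _Poisson bracket._ Bilinearity and the Leibniz rule come from those of the
    differential, and skew-symmetry from the affine bracket, so the bracket is a
    skew biderivation. Therefore it maps [A] into itself as soon as it maps pairs
    of generators into [A] ([biderivation_closed]), and its Jacobiator, which is
    a derivation in each argument, vanishes as soon as it vanishes on generators
    ([jacobiator_vanish]). On generators both facts are statements about the Lie
    algebra of affine functions ([affine_bracket_lie]), where the Jacobi identity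
    combines the one of the bracket of [W] with the cocycle condition.

    _Hamiltonian vector fields._ The field of a generator [beta] is the affine
    map [m |-> beta^sharp - ad_0^* beta (m)], and fields of products are given by
    [X_(FG) = G X_F + F X_G] ([hamiltonian_vector_field]). *)

(** * Directional derivatives in locally convex spaces *)

Section DirectionalDerivative.
Context {R : realType} {V : tvsType R}.
Implicit Types (x h : V).

Lemma is_dderive_unique (E : tvsType R) (f : V -> E) x h l l' :
  hausdorff_space E -> is_dderive f x h l -> is_dderive f x h l' -> l = l'.
Proof. by move=> hE fl fl'; apply: (cvg_unique hE fl fl'). Qed.

Lemma dderiveE (E : tvsType R) (f : V -> E) x h l :
  hausdorff_space E -> is_dderive f x h l -> dderive f x h = l.
Proof.
move=> hE fl; apply: xget_unique (fl) _ => l' fl'.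
exact: is_dderive_unique fl' fl.
Qed.

Lemma is_dderive_cst (E : tvsType R) (c : E) x h : is_dderive (fun=> c) x h 0.
Proof.
rewrite /is_dderive; under eq_fun do rewrite subrr scaler0.
exact: cvg_cst.
Qed.

Lemma is_dderive_linear (E : tvsType R) (L : V -> E) x h :
  linear L -> is_dderive L x h (L h).
Proof.
move=> linL; have : (fun=> L h) @ (0 : R)^' --> L h by exact: cvg_cst.
apply: cvg_trans; apply: near_eq_cvg; near=> t.
have t0 : t != 0 by near: t; exact: nbhs_dnbhs_neq.
by rewrite [x + _]addrC linL addrK scalerA mulVf// scale1r.
Unshelve. all: by end_near. Qed.

Lemma is_dderiveD (E : tvsType R) (f g : V -> E) x h a b :
  is_dderive f x h a -> is_dderive g x h b ->
  is_dderive (fun y => f y + g y) x h (a + b).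
Proof.
move=> fa gb; rewrite /is_dderive.
under eq_fun do rewrite opprD addrACA scalerDr.
exact: (continuous2_cvg _ (add_continuous (a, b)) fa gb).
Qed.

(** A Gateaux differentiable function is continuous along lines, because
    [f (x + t h) = f x + t q(t)] with a convergent difference quotient [q]. *)
Lemma is_dderive_cvg (E : tvsType R) (f : V -> E) x h a :
  is_dderive f x h a -> (fun t : R => f (x + t *: h)) @ 0^' --> f x.
Proof.
move=> fa.
have : (fun t : R => t *: (t^-1 *: (f (x + t *: h) - f x)) + f x) @ 0^'
    --> (0 : R^o) *: a + f x.
  apply: (continuous2_cvg _ (add_continuous (_, _))); last exact: cvg_cst.
  apply: (continuous2_cvg _ (scale_continuous (_, _))); last exact: fa.
  exact: nbhs_dnbhs.
rewrite scale0r add0r; apply: cvg_trans; apply: near_eq_cvg; near=> t.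
have t0 : t != 0 by near: t; exact: nbhs_dnbhs_neq.
by rewrite scalerA mulfV// scale1r subrK.
Unshelve. all: by end_near. Qed.

Lemma is_dderiveZ (E : tvsType R) (f : V -> R^o) (g : V -> E) x h a b :
  is_dderive f x h a -> is_dderive g x h b ->
  is_dderive (fun y => f y *: g y) x h (a *: g x + f x *: b).
Proof.
move=> fa gb; rewrite /is_dderive addrC.
have -> : (fun t : R => t^-1 *: (f (x + t *: h) *: g (x + t *: h) - f x *: g x))
   = (fun t => f (x + t *: h) *: (t^-1 *: (g (x + t *: h) - g x)) +
               (t^-1 *: (f (x + t *: h) - f x)) *: g x).
  apply/funext => t; rewrite scalerA mulrC -scalerA -scalerA -scalerDr.
  by rewrite [_ *: (_ - _) in RHS]scalerBr scalerBl addrA subrK.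
apply: (continuous2_cvg _ (add_continuous (_, _))).
  exact: (continuous2_cvg _ (scale_continuous (_, _)) (is_dderive_cvg fa) gb).
apply: (continuous2_cvg _ (scale_continuous (_, _)) fa); exact: cvg_cst.
Qed.

End DirectionalDerivative.

(** * Smoothness of polynomial maps *)

Section PolynomialMaps.
Context {R : realType} {V : tvsType R}.

(** Polynomial maps of a point [x] and of a sequence of directions [h]. The
    directions are part of the argument so that the class is closed under
    differentiation: the derivative along the [k]-th direction is again a
    polynomial map, and its joint continuity in [x] and [h] is then the joint
    continuity of the higher differentials. The codomain varies, for scalar
    polynomial maps multiply vector-valued ones. *)
Inductive poly_map (E : tvsType R) : (V -> (nat -> V) -> E) -> Prop :=
| poly_cst (c : E) : poly_map (fun _ _ => c)
| poly_point (L : V -> E) :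
    linear L -> continuous L -> poly_map (fun x _ => L x)
| poly_dir (L : V -> E) (i : nat) :
    linear L -> continuous L -> poly_map (fun _ h => L (h i))
| poly_add (f g : V -> (nat -> V) -> E) :
    poly_map f -> poly_map g -> poly_map (fun x h => f x h + g x h)
| poly_scale (f : V -> (nat -> V) -> R^o) (g : V -> (nat -> V) -> E) :
    poly_map f -> poly_map g -> poly_map (fun x h => f x h *: g x h).

(** The Leibniz rule for scalar multiplication keeps the derivative in the
    class; [k] is arbitrary, even if [f] depends on the [k]-th direction,
    because the directions are fixed while [x] moves. *)
Lemma poly_map_derive (E : tvsType R) (f : V -> (nat -> V) -> E) (k : nat) :
  poly_map f -> exists2 f' : V -> (nat -> V) -> E, poly_map f' &
    forall x h, is_dderive (f ^~ h) x (h k) (f' x h).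
Proof.
elim => {E f} [E c|E L linL cL|E L i _ _|E f g _ [f' pf' ff'] _ [g' pg' gg']
              |E f g pf [f' pf' ff'] pg [g' pg' gg']].
- by exists (fun _ _ => 0) => [|x h]; [exact: poly_cst | exact: is_dderive_cst].
- exists (fun _ h => L (h k)) => [|x h]; first exact: poly_dir.
  exact: is_dderive_linear.
- by exists (fun _ _ => 0) => [|x h]; [exact: poly_cst | exact: is_dderive_cst].
- exists (fun x h => f' x h + g' x h) => [|x h]; first exact: poly_add.
  exact: is_dderiveD.
- exists (fun x h => f' x h *: g x h + f x h *: g' x h) => [|x h].
    by apply: poly_add; exact: poly_scale.
  exact: is_dderiveZ.
Qed.

Lemma poly_map_continuous (E : tvsType R) (f : V -> (nat -> V) -> E)
    (T : topologicalType) (a : T -> V) (h : T -> nat -> V) :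
  poly_map f -> continuous a -> (forall i, continuous (h ^~ i)) ->
  continuous (fun p => f (a p) (h p)).
Proof.
move=> pf ca ch; elim: pf => {E f} [E c|E L _ cL|E L i _ cL|E f g _ cf _ cg
              |E f g _ cf _ cg] p.
- exact: cvg_cst.
- by apply: continuous_comp; [exact: ca | exact: cL].
- by apply: (continuous_comp (ch i p)); exact: cL.
- exact: (continuous2_cvg _ (add_continuous (_, _)) (cf p) (cg p)).
- exact: (continuous2_cvg _ (scale_continuous (_, _)) (cf p) (cg p)).
Qed.

(** The first [j] directions of one and the same sequence [h] are used, so that
    [g] may be differentiated once more along [h j] without knowing that it
    depends on [h 0], ..., [h j.-1] only. *)
Lemma iter_dderive_poly_map (E : tvsType R) (f : V -> E) (j : nat) :
  hausdorff_space E -> poly_map (fun x _ => f x) ->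
  exists2 g : V -> (nat -> V) -> E, poly_map g &
    forall h, iter_dderive f (mkseq h j) = g ^~ h.
Proof.
move=> hE pf; elim: j => [|j [g pg fg]]; first by exists (fun x _ => f x).
have [g' pg' gg'] := poly_map_derive j pg.
exists g' => // h; rewrite mkseqS /iter_dderive foldl_rcons.
by rewrite [foldl _ _ _]fg; apply/funext => x; exact: dderiveE.
Qed.

Lemma poly_map_smooth (E : tvsType R) (f : V -> E) :
  hausdorff_space E -> poly_map (fun x _ => f x) -> smooth f.
Proof.
move=> hE pf; split=> [hs h x|j].
  have [g pg fg] := iter_dderive_poly_map (size hs) hE pf.
  have [g' _ gg'] := poly_map_derive (size hs) pg.
  (* the next direction h is placed right after those of hs *)
  pose d := nth 0 (rcons hs h).
  have -> : hs = mkseq d (size hs).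
    apply: (@eq_from_nth _ 0) => [|i ihs]; first by rewrite size_mkseq.
    by rewrite nth_mkseq// /d nth_rcons ihs.
  rewrite fg; exists (g' x d).
  by have := gg' x d; rewrite {2}/d nth_rcons ltnn eqxx.
have [g pg fg] := iter_dderive_poly_map j hE pf.
pose d (p : V * 'rV[V]_j) := nth 0 [seq p.2 0 i | i <- enum 'I_j].
have -> : @diffn _ V E f j = fun p => g p.1 (d p).
  apply/funext => p; rewrite -[RHS]/((g ^~ (d p)) p.1) -fg /diffn.
  congr (iter_dderive _ _ _); apply: (@eq_from_nth _ 0).
    by rewrite size_mkseq size_map size_enum_ord.
  by move=> i; rewrite size_map size_enum_ord => ij; rewrite nth_mkseq.
apply: poly_map_continuous pg _ _ => [p|i]; first exact: cvg_fst.
(* beyond the length j of the row of directions, d takes the default value 0 *)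
have [ij|ji] := ltnP i j; last first.
  rewrite (_ : d ^~ i = fun=> 0); first by move=> p; exact: cvg_cst.
  by apply/funext => p; rewrite /d nth_default// size_map size_enum_ord.
rewrite (_ : d ^~ i = fun p => p.2 0 (Ordinal ij)); last first.
  apply/funext => p; rewrite /d (nth_map (Ordinal ij)) ?size_enum_ord//.
  by congr (p.2 0 _); apply/val_inj; rewrite /= nth_enum_ord.
move=> p U Up; exists (setT, [set M : 'rV[V]_j | U (M 0 (Ordinal ij))]) => /=.
  split; first exact: filterT.
  exists (fun a b => if b == Ordinal ij then U else setT) => [a b|M /(_ 0 (Ordinal ij))].
    by case: eqP => [->|_]; [rewrite (ord1 a) | exact: filterT].
  by rewrite eqxx.
by move=> q [].
Qed.

End PolynomialMaps.

(** * Linear subspaces and generated subalgebras *)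

Section LinearOn.
Context {R : realType} {W Z : lmodType R} (S : set W) (f : W -> Z).
Hypotheses (S_submod : GRing.submod_closed (mem S)) (f_linear : linear_on S f).

Lemma submod_set0 : S 0.
Proof. by case: S_submod; rewrite inE. Qed.

Lemma submod_setP a x y : S x -> S y -> S (a *: x + y).
Proof. by case: S_submod => _ /(_ a x y) + Sx Sy; rewrite !inE; apply. Qed.

Lemma submod_setZ a x : S x -> S (a *: x).
Proof. by move=> Sx; rewrite -[_ *: _]addr0; apply: submod_setP => //; exact: submod_set0. Qed.

Lemma submod_setD x y : S x -> S y -> S (x + y).
Proof. by move=> Sx Sy; rewrite -[x]scale1r; exact: submod_setP. Qed.

Lemma submod_set_sum (I : eqType) (r : seq I) (c : I -> R) (v : I -> W) :
  (forall i, i \in r -> S (v i)) -> S (\sum_(i <- r) c i *: v i).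
Proof.
move=> Sv; rewrite big_seq; elim/big_ind: _ => [|x y|i ir].
- exact: submod_set0.
- exact: submod_setD.
- by apply: submod_setZ; exact: Sv.
Qed.

Lemma linear_on0 : f 0 = 0.
Proof.
have := f_linear (-1) submod_set0 submod_set0.
by rewrite scaler0 addr0 scaleN1r addNr.
Qed.

Lemma linear_onZ a x : S x -> f (a *: x) = a *: f x.
Proof.
by move=> Sx; have := f_linear a Sx submod_set0; rewrite linear_on0 !addr0.
Qed.

Lemma linear_onD x y : S x -> S y -> f (x + y) = f x + f y.
Proof. by move=> Sx Sy; have := f_linear 1 Sx Sy; rewrite !scale1r. Qed.

Lemma linear_on_sum (I : eqType) (r : seq I) (c : I -> R) (v : I -> W) :
  (forall i, i \in r -> S (v i)) ->
  f (\sum_(i <- r) c i *: v i) = \sum_(i <- r) c i *: f (v i).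
Proof.
elim: r => [|i r IHr] Sv; first by rewrite !big_nil linear_on0.
have Sr j : j \in r -> S (v j) by move=> jr; apply: Sv; rewrite inE jr orbT.
rewrite !big_cons f_linear ?IHr//; first by apply: Sv; rewrite mem_head.
exact: submod_set_sum.
Qed.

End LinearOn.

Lemma unital_subalgebraP (R : realType) (T : Type) (B : set (T -> R^o)) :
  unital_subalgebra B <->
  [/\ B 1, forall a F G, B F -> B G -> B (a *: F + G) &
      forall F G, B F -> B G -> B (F * G)].
Proof.
split=> [[[_ Blin] [/set_mem B1 Bmul]]|[B1 Blin Bmul]].
  split=> // [a F G /mem_set BF /mem_set BG|F G /mem_set BF /mem_set BG].
    by apply: set_mem; exact: Blin.
  by apply: set_mem; exact: Bmul.
split; split; do ?[exact: mem_set].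
- by apply: mem_set; rewrite -[0](addNr 1) -scaleN1r; exact: Blin.
- by move=> a F G /set_mem BF /set_mem BG; apply: mem_set; exact: Blin.
- by move=> F G /set_mem BF /set_mem BG; apply: mem_set; exact: Bmul.
Qed.

Section GeneratedSubalgebra.
Context {R : realType} {V : tvsType R} (W : set (V -> R^o)).
Notation A := (generated_subalgebra W).

Lemma generated_subalgebra_closed : unital_subalgebra A.
Proof.
apply/unital_subalgebraP; split.
- by move=> B [/unital_subalgebraP[]].
- move=> a F G AF AG B CB; have [/unital_subalgebraP[_ Blin _] _] := CB.
  by apply: Blin; [exact: AF | exact: AG].
- move=> F G AF AG B CB; have [/unital_subalgebraP[_ _ Bmul] _] := CB.
  by apply: Bmul; [exact: AF | exact: AG].
Qed.

Lemma generated_submod : GRing.submod_closed (mem A).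
Proof. by case: generated_subalgebra_closed. Qed.

Lemma generated_one : A 1.
Proof. by have /unital_subalgebraP[] := generated_subalgebra_closed. Qed.

Lemma generated_mul F G : A F -> A G -> A (F * G).
Proof. by have /unital_subalgebraP[_ _] := generated_subalgebra_closed; exact. Qed.

Lemma generated_gen : W `<=` A.
Proof. exact: sub_gen_smallest. Qed.

(** The polynomial functions satisfying [P] form a unital subalgebra. Stability
    under sums and products may use that the arguments lie in the generated
    algebra; this is what allows [P] to speak of brackets and differentials. *)
Lemma generated_subalgebra_ind (P : (V -> R^o) -> Prop) :
  P 1 -> (forall alpha, W alpha -> P alpha) ->
  (forall a F G, A F -> A G -> P F -> P G -> P (a *: F + G)) ->
  (forall F G, A F -> A G -> P F -> P G -> P (F * G)) ->
  forall F, A F -> P F.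
Proof.
move=> P1 PW Plin Pmul F AF.
suff /(_ F AF)[] : A `<=` A `&` P by [].
apply: smallest_sub => [|alpha Wa]; last by split; [exact: generated_gen|exact: PW].
apply/unital_subalgebraP; split.
- by split=> //; exact: generated_one.
- move=> a G H [AG PG] [AH PH]; split; last exact: Plin.
  exact: (submod_setP generated_submod).
- move=> G H [AG PG] [AH PH].
  by split; [exact: generated_mul | exact: Pmul].
Qed.

End GeneratedSubalgebra.

(** * Polynomial functions and the symmetric algebra *)

Section Interpolation.
Context {R : realType} {T : eqType} (W : set (T -> R^o)).
Hypothesis W_submod : GRing.submod_closed (mem W).

(** Finitely many functions are recovered from their values at finitely many
    points [v_p], through an expansion [alpha = \sum_p alpha(v_p) e_p] with fixed
    coefficient functions [e_p]. To adjoin a function [b], let [b'] be the error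
    of the expansion for [b]; if [b'] is not zero, choose [w] with [b' w != 0] and
    take [w] as a new point, with coefficient function [b' / b' w]. *)
Lemma finite_interpolation (s : seq (T -> R^o)) :
  (forall alpha, alpha \in s -> W alpha) ->
  exists2 l : seq ((T -> R^o) * T), forall p, p \in l -> W p.1 &
    forall alpha, alpha \in s -> alpha = \sum_(p <- l) alpha p.2 *: p.1.
Proof.
elim: s => [|b s IHs] Ws; first by exists [::].
have [|l Wl sl] := IHs; first by move=> a sa; apply: Ws; rewrite inE sa orbT.
have Wb : W b by apply: Ws; rewrite mem_head.
pose b' : T -> R^o := b - \sum_(p <- l) b p.2 *: p.1.
have Wb' : W b'.
  rewrite /b' addrC -scaleN1r; apply: submod_setP => //; exact: submod_set_sum.
have [b'0|/existsNP[w b'w]] := pselect (forall x, b' x = 0).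
  exists l => // a; rewrite inE => /orP[/eqP ->|/sl//].
  by apply/eqP; rewrite -subr_eq0; apply/eqP/funext.
pose e : T -> R^o := (b' w)^-1 *: b'.
(* the old coefficient functions are corrected so as to vanish at the new point w *)
exists ((e, w) :: [seq (p.1 - p.1 w *: e, p.2) | p <- l]) => [p|].
  rewrite inE => /predU1P[->|/mapP[q lq ->]]; first exact: submod_setZ.
  by rewrite addrC -scaleNr; apply: submod_setP => //; [exact: submod_setZ|exact: Wl].
have expand (a : T -> R^o) :
    \sum_(p <- (e, w) :: [seq (p.1 - p.1 w *: e, p.2) | p <- l]) a p.2 *: p.1 =
    \sum_(p <- l) a p.2 *: p.1 + (a - \sum_(p <- l) a p.2 *: p.1) w *: e.
  rewrite big_cons big_map /=.
  have -> : (a - \sum_(p <- l) a p.2 *: p.1) w = a w - \sum_(p <- l) a p.2 * p.1 w.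
    by rewrite fct_sumE.
  rewrite scalerBl scaler_suml addrCA -sumrB; congr (_ + _).
  by apply: eq_bigr => p _; rewrite scalerBr scalerA.
move=> a; rewrite inE expand => /predU1P[->|/sl aE].
  rewrite -/b' scalerA mulfV ?scale1r; last exact/eqP.
  by rewrite addrC subrK.
by rewrite -aE subrr scale0r addr0.
Qed.

End Interpolation.

Section PolynomialIdentity.
Context {R : realType} (B : comAlgType R).

(** A polynomial has only finitely many roots among the natural numbers, even
    over a real algebra [B] with zero divisors: differences of distinct natural
    numbers are invertible in [B], so linear factors can be split off and
    cancelled. *)
Lemma poly_eventually_zero (m : nat) (p : {poly B}) :
  (forall i, (m <= i)%N -> p.[i%:R] = 0) -> p = 0.
Proof.
move sp : (size p) => n; elim/ltn_ind: n p sp m => n IHn p sp m p0.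
have /factor_theorem[q pq] : root p m%:R by apply/eqP/p0.
have [q0|q0] := eqVneq q 0; first by rewrite pq q0 mul0r.
have q0' : q = 0.
  apply: (IHn (size q) _ q erefl m.+1) => [|i mi].
    by rewrite -sp pq size_Mmonic ?monicXsubC// size_XsubC addn2.
  have := p0 i (ltnW mi).
  rewrite pq hornerM hornerXsubC -natrB; last exact: ltnW.
  rewrite mulr_natr -scaler_nat => qi.
  have d0 : (i - m)%:R != 0 :> R by rewrite pnatr_eq0 subn_eq0 -ltnNge.
  by rewrite -[LHS]scale1r -(mulVf d0) -scalerA qi scaler0.
by rewrite pq q0' mul0r.
Qed.

End PolynomialIdentity.

Section PolynomialTerms.
Context {R : realType} (X : eqType).

(** Polynomial expressions in the variables [X]. They can be evaluated in every
    commutative algebra, which polynomial functions cannot. *)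
Inductive pterm := PConst of R | PVar of X | PAdd of pterm & pterm
  | PMul of pterm & pterm.

Fixpoint peval (B : comAlgType R) (chi : X -> B) (t : pterm) : B :=
  match t with
  | PConst r => r%:A
  | PVar x => chi x
  | PAdd t u => peval chi t + peval chi u
  | PMul t u => peval chi t * peval chi u
  end.

Fixpoint pvars (t : pterm) : seq X :=
  match t with
  | PConst _ => [::]
  | PVar x => [:: x]
  | PAdd t u | PMul t u => pvars t ++ pvars u
  end.

Lemma eq_in_peval (B : comAlgType R) (chi psi : X -> B) (t : pterm) :
  {in pvars t, chi =1 psi} -> peval chi t = peval psi t.
Proof.
elim: t => //= [x|t IHt u IHu|t IHt u IHu] h; first by apply: h; rewrite mem_head.
- by rewrite IHt ?IHu// => x xt; apply: h; rewrite mem_cat xt ?orbT.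
- by rewrite IHt ?IHu// => x xt; apply: h; rewrite mem_cat xt ?orbT.
Qed.

Lemma peval_scalar (B : comAlgType R) (chi : X -> R^o) (t : pterm) :
  peval (fun x => (chi x)%:A : B) t = (peval chi t : R)%:A.
Proof.
elim: t => //= [r|t -> u ->|t -> u ->]; first by rewrite /GRing.scale/= mulr1.
- by rewrite scalerDl.
- by rewrite -scalerAl mul1r scalerA.
Qed.

Lemma peval_line (B : comAlgType R) (chi psi : X -> B) (t : pterm) :
  exists p : {poly B}, forall b,
    peval (fun x => chi x + b * psi x) t = p.[b].
Proof.
elim: t => /= [r|x|t [p pE] u [q qE]|t [p pE] u [q qE]].
- by exists (r%:A)%:P => b; rewrite hornerC.
- by exists ((chi x)%:P + 'X * (psi x)%:P) => b; rewrite !hornerE.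
- by exists (p + q) => b; rewrite hornerD pE qE.
- by exists (p * q) => b; rewrite hornerM pE qE.
Qed.

(** Vanishing at the natural numbers on an affine line spreads to all its points
    with parameter in [B]: this replaces real scalars by elements of [B]. *)
Lemma peval_line_vanish (B : comAlgType R) (chi psi : X -> B) (t : pterm) :
  (forall n : nat, peval (fun x => chi x + n%:R * psi x) t = 0) ->
  forall b, peval (fun x => chi x + b * psi x) t = 0.
Proof.
move=> t0 b; have [p pE] := peval_line chi psi t.
rewrite pE (@poly_eventually_zero _ _ 0%N p) ?horner0// => n _.
by rewrite -pE.
Qed.

End PolynomialTerms.

Section SymmetricAlgebra.
Context {R : realType} {V : tvsType R} (W : set (V -> R^o)).
Hypotheses (W_linear : forall alpha, W alpha -> linear alpha)
  (W_submod : GRing.submod_closed (mem W)).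
Notation A := (generated_subalgebra W).
(* The variables carry the proof that they belong to W, so that every term
   denotes an element of the generated algebra. *)
Notation X := {alpha : V -> R^o | `[< W alpha >]}.

Definition polyfun (t : pterm X) : V -> R^o :=
  fun v => peval (fun x : X => val x v : R^o) t.

Lemma valW (x : X) : W (val x).
Proof. by case: x => alpha /= /asboolP. Qed.

Lemma functional0 alpha : W alpha -> alpha 0 = 0.
Proof.
move=> /W_linear lin; have := lin (-1) 0 0.
by rewrite scaler0 addr0 scaleN1r addNr.
Qed.

(** An expression that vanishes as a function on [V] vanishes at all characters
    [alpha |-> alpha(v)], hence, by replacing real coordinates by elements of [B]
    one after the other, at all characters
    [alpha |-> alpha(v) + \sum_q b_q alpha(w_q)] with values in [B]. *)
Lemma polyfun_generators (B : comAlgType R) (t : pterm X) (l : seq (B * V)) (v : V) :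
  polyfun t = 0 ->
  peval (fun x : X => (val x v)%:A + \sum_(q <- l) q.1 * (val x q.2)%:A) t = 0.
Proof.
move=> t0; elim: l v => [|[b w] l IHl] v.
  under [X in peval X]funext do rewrite big_nil addr0.
  by rewrite (peval_scalar B (fun x : X => val x v)) -/(polyfun t v) t0 scale0r.
under [X in peval X]funext do rewrite big_cons /= addrCA [_ * _ + _]addrC.
(* a natural number n in place of the coefficient of w moves v to v + n w *)
apply: peval_line_vanish => n; rewrite -[RHS](IHl (v + n%:R *: w)).
congr peval; apply/funext => x; rewrite addrAC; congr (_ + _).
rewrite [v + _]addrC (W_linear (valW x)) scalerDl addrC; congr (_ + _).
by rewrite mulr_natl -[(_ *: _)%:A]scalerA scaler_nat.
Qed.

(** On the finitely many variables of [t], every linear map [phi] has the form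
    treated in [polyfun_generators]: by interpolation
    [phi(alpha) = \sum_p phi(e_p) alpha(v_p)]. *)
Lemma polyfun_vanish (B : comAlgType R) (phi : (V -> R^o) -> B) (t : pterm X) :
  linear_on W phi -> polyfun t = 0 -> peval (fun x : X => phi (val x)) t = 0.
Proof.
move=> lin_phi t0.
have [|l Wl tl] := @finite_interpolation _ _ _ W_submod (map val (pvars t)).
  by move=> _ /mapP[x _ ->]; exact: valW.
rewrite -[RHS](polyfun_generators [seq (phi p.1, p.2) | p <- l] 0 t0).
apply: eq_in_peval => x xt.
rewrite (functional0 (valW x)) scale0r add0r big_map /=.
rewrite {1}(tl (val x)); last exact: map_f.
rewrite (linear_on_sum W_submod lin_phi) => [|p lp]; last exact: Wl.
by apply: eq_bigr => p _; rewrite -scalerAr mulr1.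
Qed.

Lemma polyfun_surj F : A F -> exists t, polyfun t = F.
Proof.
move: F; apply: generated_subalgebra_ind.
- by exists (PConst _ 1); apply/funext => v; rewrite /polyfun /= scale1r.
- by move=> alpha Wa; exists (PVar (exist _ alpha (asboolT Wa))).
- move=> a G H _ _ [t <-] [u <-].
  exists (PAdd (PMul (PConst _ a) t) u); apply/funext => v.
  by rewrite /polyfun /= -scalerAl mul1r.
- by move=> G H _ _ [t <-] [u <-]; exists (PMul t u).
Qed.

(** The extension of [phi] evaluates, at [phi], any expression that represents
    the given function. By [polyfun_vanish] the result does not depend on the
    expression: there are no polynomial relations between linear functionals
    other than those that follow from linearity. *)
Lemma symmetric_algebra_generated : is_symmetric_algebra W A.
Proof.
split=> [|B phi lin_phi]; first exact: generated_gen.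
pose ev := peval (fun x : X => phi (val x)).
have evE t u : polyfun t = polyfun u -> ev t = ev u.
  move=> tu; apply/eqP; rewrite -subr_eq0; apply/eqP.
  have := @polyfun_vanish B phi (PAdd t (PMul (PConst _ (-1)) u)) lin_phi.
  rewrite /= scaleN1r mulN1r; apply; apply/funext => v.
  by rewrite /polyfun /= scaleN1r mulN1r -/(polyfun t v) tu subrr.
pose Phi F : B := xget 0 [set b | exists2 t, polyfun t = F & b = ev t].
have PhiE t : Phi (polyfun t) = ev t.
  by apply: xget_unique => [|_ [u ut ->]]; [exists t | exact: evE].
have morPhi : algebra_morphism_on A Phi.
  split=> [a F G /polyfun_surj[t <-] /polyfun_surj[u <-]||
           F G /polyfun_surj[t <-] /polyfun_surj[u <-]].
  - rewrite !PhiE.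
    have -> : a *: polyfun t + polyfun u = polyfun (PAdd (PMul (PConst _ a) t) u).
      by apply/funext => v; rewrite /polyfun /= -scalerAl mul1r.
    by rewrite PhiE /ev /= -scalerAl mul1r.
  - have -> : 1 = polyfun (PConst _ 1) by apply/funext => v; rewrite /polyfun /= scale1r.
    by rewrite PhiE /ev /= scale1r.
  - by rewrite !PhiE -[RHS](PhiE (PMul t u)).
have Phiphi w : W w -> Phi w = phi w.
  by move=> Ww; rewrite -[RHS](PhiE (PVar (exist _ w (asboolT Ww)))).
exists Phi; split=> // Psi [linPsi Psi1 PsiM] Psiphi F.
have [linPhi Phi1 PhiM] := morPhi.
move: F; apply: generated_subalgebra_ind.
- by rewrite Psi1 Phi1.
- by move=> alpha Wa; rewrite Psiphi ?Phiphi.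
- by move=> a G H AG AH GE HE; rewrite linPsi// linPhi// GE HE.
- by move=> G H AG AH GE HE; rewrite PsiM// PhiM// GE HE.
Qed.

End SymmetricAlgebra.

(** * Derivations and biderivations of a generated algebra *)

Section Derivations.
Context {R : realType} {V : tvsType R} (W : set (V -> R^o)).
Notation A := (generated_subalgebra W).

Definition derivation_on (D : (V -> R^o) -> (V -> R^o)) : Prop :=
  linear_on A D /\ forall F G, A F -> A G -> D (F * G) = D F * G + F * D G.

Lemma derivation_one D : derivation_on D -> D 1 = 0.
Proof.
have A1 : A 1 by exact: generated_one.
by case=> _ /(_ 1 1 A1 A1)/eqP; rewrite !mulr1 mul1r -subr_eq0 opprD addNKr oppr_eq0 => /eqP.
Qed.

Lemma derivation_closed D : derivation_on D ->
  (forall alpha, W alpha -> A (D alpha)) -> forall F, A F -> A (D F).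
Proof.
move=> derD DW; have [linD DM] := derD; have submodA := generated_submod W.
apply: generated_subalgebra_ind => //.
- by rewrite derivation_one//; exact: (submod_set0 submodA).
- by move=> a F G AF AG ADF ADG; rewrite linD//; exact: (submod_setP submodA).
- move=> F G AF AG ADF ADG; rewrite DM//.
  by apply: (submod_setD submodA); exact: generated_mul.
Qed.

Lemma derivation_vanish D : derivation_on D ->
  (forall alpha, W alpha -> D alpha = 0) -> forall F, A F -> D F = 0.
Proof.
move=> derD DW; have [linD DM] := derD.
apply: generated_subalgebra_ind => //.
- exact: derivation_one.
- by move=> a F G AF AG DF0 DG0; rewrite linD// DF0 DG0 scaler0 addr0.
- by move=> F G AF AG DF0 DG0; rewrite DM// DF0 DG0 mul0r mulr0 addr0.
Qed.

End Derivations.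

Section Biderivations.
Context {R : realType} {V : tvsType R} (W : set (V -> R^o)).
Notation A := (generated_subalgebra W).
Variable pb : (V -> R^o) -> (V -> R^o) -> (V -> R^o).
Hypotheses (pb_skew : forall F G, A F -> A G -> pb F G = - pb G F)
  (pb_derivation : forall F, A F -> derivation_on W (pb F)).

Lemma biderivation_l G : A G -> derivation_on W (pb ^~ G).
Proof.
move=> AG; have [linG GM] := pb_derivation AG.
have submodA := generated_submod W.
have skew K : A K -> pb K G = - pb G K by move=> AK; exact: pb_skew.
split=> [a F H AF AH|F H AF AH].
  rewrite !skew//; last exact: (submod_setP submodA).
  by rewrite linG// opprD scalerN.
rewrite !skew//; last exact: generated_mul.
by rewrite GM// opprD mulrN mulNr.
Qed.

(** One argument at a time: with one of them fixed, the bracket is a derivation,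
    so that [derivation_closed] reduces the other one to generators. *)
Lemma biderivation_closed :
  (forall alpha beta, W alpha -> W beta -> A (pb alpha beta)) ->
  forall F G, A F -> A G -> A (pb F G).
Proof.
move=> pbW F G + AG; move: F.
apply: (derivation_closed (biderivation_l AG)) => alpha Wa; move: G AG.
apply: (derivation_closed (pb_derivation (generated_gen Wa))) => beta Wb.
exact: pbW.
Qed.

Hypothesis pb_closed : forall F G, A F -> A G -> A (pb F G).

Definition jacobiator F G H := pb (pb F G) H + pb (pb G H) F + pb (pb H F) G.

Lemma jacobiator_cyclic F G H : jacobiator F G H = jacobiator G H F.
Proof. by rewrite /jacobiator addrAC addrC addrA addrAC. Qed.

(** The terms of the Leibniz expansion in which both factors of the product are
    hit by a bracket cancel by skew-symmetry. *)
Lemma jacobiator_derivation G H : A G -> A H ->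
  derivation_on W (fun F => jacobiator F G H).
Proof.
move=> AG AH; have submodA := generated_submod W.
have [linG GM] := biderivation_l AG.
have [linH HM] := biderivation_l AH.
have [linH' HM'] := pb_derivation AH.
have [linGH GHM] := pb_derivation (pb_closed AG AH).
split=> [a F K AF AK|F K AF AK]; rewrite /jacobiator;
  have [AFG AKG] := (pb_closed AF AG, pb_closed AK AG);
  have [AHF AHK] := (pb_closed AH AF, pb_closed AH AK).
  have -> : pb (pb (a *: F + K) G) H = a *: pb (pb F G) H + pb (pb K G) H.
    by rewrite linG//; exact: linH.
  have -> : pb (pb H (a *: F + K)) G = a *: pb (pb H F) G + pb (pb H K) G.
    by rewrite linH'//; exact: linG.
  rewrite linGH//.
  move: (pb (pb F G) H) (pb (pb K G) H) (pb (pb G H) F) (pb (pb G H) K).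
  move: (pb (pb H F) G) (pb (pb H K) G) => x1 y1 x2 y2 x3 y3.
  by rewrite !scalerDr [X in X + _ = _]addrACA [LHS]addrACA.
have -> : pb (pb (F * K) G) H = pb (pb F G) H * K + pb F G * pb K H
    + (pb F H * pb K G + F * pb (pb K G) H).
  rewrite GM// (linear_onD linH); do ?exact: generated_mul.
  by rewrite !HM.
have -> : pb (pb H (F * K)) G = pb (pb H F) G * K + pb H F * pb K G
    + (pb F G * pb H K + F * pb (pb H K) G).
  rewrite HM'// (linear_onD linG); do ?exact: generated_mul.
  by rewrite !GM.
rewrite GHM//.
have := pb_skew AH AK; have := pb_skew AH AF.
move: (pb F G) (pb K G) (pb F H) (pb K H) (pb H F) (pb H K) => fg kg fh kh hf hk.
move: (pb fg H) (pb kg H) (pb (pb G H) F) (pb (pb G H) K) (pb hf G) (pb hk G).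
by move=> a1 a2 b1 b2 c1 c2 -> ->; ring.
Qed.

(** The Jacobiator is a derivation in each argument, so the Jacobi identity need
    only be checked on generators: cyclic symmetry moves each argument in turn to
    the first position, where [derivation_vanish] applies. *)
Lemma jacobiator_vanish :
  (forall alpha beta gamma, W alpha -> W beta -> W gamma ->
    jacobiator alpha beta gamma = 0) ->
  forall F G H, A F -> A G -> A H -> jacobiator F G H = 0.
Proof.
move=> jacW F G H AF AG AH; rewrite -jacobiator_cyclic.
apply: (derivation_vanish (jacobiator_derivation AF AG)) AH => gamma Wc.
have Ac := generated_gen Wc; rewrite -jacobiator_cyclic.
apply: (derivation_vanish (jacobiator_derivation Ac AF)) AG => beta Wb.
have Ab := generated_gen Wb; rewrite -jacobiator_cyclic.
apply: (derivation_vanish (jacobiator_derivation Ab Ac)) AF => alpha Wa.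
exact: jacW.
Qed.

End Biderivations.

(** * Differentials of polynomial functions *)

Section Differential.
Context {R : realType} {V : tvsType R} (W : set (V -> R^o)).
Hypotheses (W_dual : W `<=` topological_dual V)
  (W_submod : GRing.submod_closed (mem W)).
Notation A := (generated_subalgebra W).

Lemma hausdorff_regular : hausdorff_space R^o.
Proof. exact: (@Rhausdorff R). Qed.

Lemma generated_poly_map F : A F -> poly_map (fun (x : V) _ => F x).
Proof.
move: F; apply: generated_subalgebra_ind.
- exact: poly_cst.
- by move=> alpha /W_dual[lin cont]; exact: poly_point.
- move=> a F G _ _ PF PG.
  exact: (poly_add (poly_scale (poly_cst (a : R^o)) PF) PG).
- by move=> F G _ _ PF PG; exact: (poly_scale PF PG).
Qed.

(** The Leibniz rule [d(FG)(v) = G(v) dF(v) + F(v) dG(v)] shows why the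
    differential stays in [W]: it is a linear combination of the differentials of
    the generators, which are the generators themselves. *)
Lemma generated_differentiable F v : A F ->
  exists2 alpha, W alpha & forall h, is_dderive F v h (alpha h).
Proof.
move: F; apply: generated_subalgebra_ind.
- by exists 0 => [|h]; [exact: submod_set0 | exact: is_dderive_cst].
- move=> alpha Wa; exists alpha => // h.
  by apply: is_dderive_linear; case: (W_dual Wa).
- move=> a F G _ _ [alpha Wa Fa] [beta Wb Gb].
  exists (a *: alpha + beta) => [|h]; first exact: submod_setP.
  apply: is_dderiveD (Gb h).
  have := is_dderiveZ (is_dderive_cst (a : R^o) v h) (Fa h).
  by rewrite scale0r add0r.
- move=> F G _ _ [alpha Wa Fa] [beta Wb Gb].
  exists (G v *: alpha + F v *: beta) => [|h].
    by apply: submod_setP => //; exact: submod_setZ.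
  have := is_dderiveZ (Fa h) (Gb h).
  by rewrite [_ *: G v]mulrC.
Qed.

Lemma is_dderive_generated F v h : A F -> is_dderive F v h (dderive F v h).
Proof.
move=> /(generated_differentiable v)[alpha _ /(_ h) Fa].
by rewrite (dderiveE hausdorff_regular Fa).
Qed.

Lemma dderive_generated F v : A F -> W (dderive F v).
Proof.
move=> /(generated_differentiable v)[alpha Wa Fa].
suff -> : dderive F v = alpha by [].
by apply/funext => h; exact: (dderiveE hausdorff_regular (Fa h)).
Qed.

Lemma dderive_functional alpha v : W alpha -> dderive alpha v = alpha.
Proof.
move=> /W_dual[lin _]; apply/funext => h.
by apply: (dderiveE hausdorff_regular); exact: is_dderive_linear.
Qed.

Lemma dderive_cst (c : R^o) (v : V) : dderive (cst c) v = 0 :> (V -> R^o).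
Proof.
apply/funext => h; by rewrite (dderiveE hausdorff_regular (is_dderive_cst (c : R^o) v h)).
Qed.

Lemma dderive_lin a F G v : A F -> A G ->
  dderive (a *: F + G) v = a *: dderive F v + dderive G v.
Proof.
move=> AF AG; apply/funext => h; apply: (dderiveE hausdorff_regular).
apply: is_dderiveD (@is_dderive_generated G v h AG).
have := is_dderiveZ (is_dderive_cst (a : R^o) v h) (@is_dderive_generated F v h AF).
by rewrite scale0r add0r.
Qed.

Lemma dderive_mul F G v : A F -> A G ->
  dderive (F * G) v = G v *: dderive F v + F v *: dderive G v.
Proof.
move=> AF AG; apply/funext => h; apply: (dderiveE hausdorff_regular).
have := is_dderiveZ (@is_dderive_generated F v h AF) (@is_dderive_generated G v h AG).
by rewrite [_ *: G v]mulrC.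
Qed.

End Differential.

(** * The Lie algebra of affine functions *)

Section AffineBracket.
Context {R : realType} {V : tvsType R} (W : set (V -> R^o))
  (Lambda : (V -> R^o) -> (V -> R^o) -> R^o)
  (br0 : (V -> R^o) -> (V -> R^o) -> (V -> R^o)).
Hypotheses (W_dual : W `<=` topological_dual V)
  (W_submod : GRing.submod_closed (mem W))
  (Lambda_bilinear : bilinear_on W Lambda)
  (Lambda_skew : forall alpha beta, W alpha -> W beta ->
      Lambda alpha beta = - Lambda beta alpha)
  (br0_lie : lie_bracket_on W br0)
  (Lambda_cocycle : forall alpha beta gamma, W alpha -> W beta -> W gamma ->
      Lambda (br0 alpha beta) gamma + Lambda (br0 beta gamma) alpha
        + Lambda (br0 gamma alpha) beta = 0).
Notation b := (affine_bracket Lambda br0).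

Lemma dual0 alpha : W alpha -> alpha 0 = 0.
Proof. by apply: functional0 => beta /W_dual[]. Qed.

Lemma linear_part_affine t alpha : W alpha -> linear_part (cst t + alpha) = alpha.
Proof.
by move=> Wa; apply/funext => v; rewrite /linear_part !fctE (dual0 Wa) addr0 addrC addKr.
Qed.

Lemma linear_part_dual alpha : W alpha -> linear_part alpha = alpha.
Proof. by move=> Wa; apply/funext => v; rewrite /linear_part !fctE dual0// subr0. Qed.

Lemma linear_part_closed f : affine_functions W f -> W (linear_part f).
Proof. by move=> [t [alpha Wa ->]]; rewrite linear_part_affine. Qed.

Lemma linear_part_lin a (f g : V -> R^o) :
  linear_part (a *: f + g) = a *: linear_part f + linear_part g.
Proof. by apply/funext => v; rewrite /linear_part !fctE scalerBr opprD addrACA. Qed.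

Lemma affine_bracket_dual alpha beta : W alpha -> W beta ->
  b alpha beta = cst (Lambda alpha beta) + br0 alpha beta.
Proof. by move=> Wa Wb; rewrite /affine_bracket !linear_part_dual. Qed.

Lemma affine_bracketE t s alpha beta : W alpha -> W beta ->
  b (cst t + alpha) (cst s + beta) = b alpha beta.
Proof.
by move=> Wa Wb; rewrite [RHS]affine_bracket_dual// /affine_bracket !linear_part_affine.
Qed.

Lemma affine_dual alpha : W alpha -> affine_functions W alpha.
Proof. by move=> Wa; exists 0, alpha => //; rewrite [cst 0]/(0 : V -> R^o) add0r. Qed.

Lemma linear_part_bracket f g : affine_functions W f -> affine_functions W g ->
  linear_part (b f g) = br0 (linear_part f) (linear_part g).
Proof.
move=> /linear_part_closed Wf /linear_part_closed Wg.
by rewrite linear_part_affine//; exact: (lie_closed br0_lie).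
Qed.

Lemma affine_bracket_linl a f g h :
  affine_functions W f -> affine_functions W g -> affine_functions W h ->
  b (a *: f + g) h = a *: b f h + b g h.
Proof.
move=> /linear_part_closed Wf /linear_part_closed Wg /linear_part_closed Wh.
have [_ /(_ _ Wh) Ll] := Lambda_bilinear.
have [_ /(_ _ Wh) Bl] := lie_bilinear br0_lie.
rewrite /affine_bracket linear_part_lin Ll// Bl// scalerDr addrACA.
by congr (_ + _).
Qed.

Lemma affine_bracket_skew f g : affine_functions W f -> affine_functions W g ->
  b f g = - b g f.
Proof.
move=> /linear_part_closed Wf /linear_part_closed Wg.
rewrite /affine_bracket Lambda_skew// opprD; congr (_ + _).
set x := linear_part f in Wf *; set y := linear_part g in Wg *.
have [Br Bl] := lie_bilinear br0_lie; have alt := lie_alternating br0_lie.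
have Wxy : W (x + y) by exact: submod_setD.
have := alt _ Wxy; rewrite (linear_onD (Br _ Wxy))//.
rewrite (linear_onD (Bl _ Wf))// (linear_onD (Bl _ Wg))// !alt//.
by rewrite add0r addr0 addrC => /eqP; rewrite addr_eq0 => /eqP.
Qed.

(** Constants are central and the linear part of a bracket is the bracket of the
    linear parts. So the Jacobi identity splits into the one of [br0] and, in the
    constant part, the cocycle condition. *)
Lemma affine_bracket_lie : lie_bracket_on (affine_functions W) b.
Proof.
have linP a f g : affine_functions W f -> affine_functions W g ->
    affine_functions W (a *: f + g).
  move=> [t [alpha Wa ->]] [s [beta Wb ->]].
  exists (a * t + s), (a *: alpha + beta); first exact: submod_setP.
  by rewrite scalerDr addrACA.
split.
- move=> f g /linear_part_closed Wf /linear_part_closed Wg.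
  eexists; exists (br0 (linear_part f) (linear_part g)); last by [].
  exact: (lie_closed br0_lie).
- split=> f Wf a g h Wg Wh; last exact: affine_bracket_linl.
  rewrite affine_bracket_skew//; last exact: linP.
  by rewrite affine_bracket_linl// opprD -scalerN -!affine_bracket_skew.
- move=> f /linear_part_closed Wf; rewrite /affine_bracket (lie_alternating br0_lie)//.
  suff -> : Lambda (linear_part f) (linear_part f) = 0 by rewrite addr0.
  apply/eqP; have /eqP := Lambda_skew Wf Wf.
  by rewrite -addr_eq0 -mulr2n mulrn_eq0.
- move=> f g h af ag ah.
  have [Wf Wg Wh] := And3 (linear_part_closed af) (linear_part_closed ag)
    (linear_part_closed ah).
  rewrite [b (b f g) h]/affine_bracket [b (b g h) f]/affine_bracket.
  rewrite [b (b h f) g]/affine_bracket !linear_part_bracket//.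
  apply/funext => v.
  have jac := congr1 (fun F => F v) (lie_jacobi br0_lie Wf Wg Wh).
  have coc := Lambda_cocycle Wf Wg Wh.
  rewrite -[RHS]/(0 : R) -[RHS]addr0 -{1}coc -[X in _ = _ + X]jac.
  by rewrite !fctE; ring.
Qed.

End AffineBracket.

(** * The Poisson bracket *)

Section PoissonBracket.
Context {R : realType} {V : tvsType R} (W : set (V -> R^o))
  (Lambda : (V -> R^o) -> (V -> R^o) -> R^o)
  (br0 : (V -> R^o) -> (V -> R^o) -> (V -> R^o)).
Hypotheses (W_dual : W `<=` topological_dual V)
  (W_submod : GRing.submod_closed (mem W))
  (Lambda_bilinear : bilinear_on W Lambda)
  (Lambda_skew : forall alpha beta, W alpha -> W beta ->
      Lambda alpha beta = - Lambda beta alpha)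
  (br0_lie : lie_bracket_on W br0)
  (Lambda_cocycle : forall alpha beta gamma, W alpha -> W beta -> W gamma ->
      Lambda (br0 alpha beta) gamma + Lambda (br0 beta gamma) alpha
        + Lambda (br0 gamma alpha) beta = 0).
Notation A := (generated_subalgebra W).
Notation b := (affine_bracket Lambda br0).
Notation pb := (poisson_bracket Lambda br0).

Let affW alpha : W alpha -> affine_functions W alpha.
Proof. exact: affine_dual. Qed.

Let b_lie : lie_bracket_on (affine_functions W) b.
Proof. exact: affine_bracket_lie. Qed.

Let DW F v : A F -> W (dderive F v).
Proof. exact: dderive_generated. Qed.

Lemma affine_bracket_linear gamma : W gamma -> linear_on W (b gamma).
Proof.
move=> Wc a alpha beta Wa Wb; have [lin _] := lie_bilinear b_lie.
exact: (lin _ (affW Wc) a _ _ (affW Wa) (affW Wb)).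
Qed.

Lemma poisson_bracket_skew F G : A F -> A G -> pb F G = - pb G F.
Proof.
move=> AF AG; apply/funext => v; rewrite /poisson_bracket.
by rewrite (affine_bracket_skew W_dual W_submod Lambda_skew br0_lie)//; apply: affW; exact: DW.
Qed.

Lemma poisson_derivation F : A F -> derivation_on W (pb F).
Proof.
move=> AF; split=> [a G H AG AH|G H AG AH]; apply/funext => v.
  rewrite /poisson_bracket (dderive_lin W_dual W_submod)//.
  by rewrite (affine_bracket_linear (DW v AF))//; exact: DW.
rewrite /poisson_bracket (dderive_mul W_dual W_submod)//.
have lin := affine_bracket_linear (DW v AF).
rewrite lin; do ?[exact: DW | exact: (submod_setZ W_submod _ (DW _ _))].
rewrite (linear_onZ W_submod lin _ (DW v AH)) !fctE.
by rewrite /GRing.scale/= mulrC.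
Qed.

Lemma poisson_bracket_dual alpha beta : W alpha -> W beta ->
  pb alpha beta = b alpha beta.
Proof.
move=> Wa Wb; apply/funext => v.
by rewrite /poisson_bracket !(dderive_functional W_dual).
Qed.

Lemma affine_generated f : affine_functions W f -> A f.
Proof.
move=> [t [alpha Wa ->]].
have -> : cst t = t *: (1 : V -> R^o) by apply/funext => v; rewrite !fctE [RHS]mulr1.
apply: (submod_setP (generated_submod W)); first exact: generated_one.
exact: generated_gen.
Qed.

Lemma poisson_bracket_closed F G : A F -> A G -> A (pb F G).
Proof.
apply: (biderivation_closed poisson_bracket_skew poisson_derivation) => alpha beta Wa Wb.
rewrite poisson_bracket_dual//; apply: affine_generated.
by apply: (lie_closed b_lie); exact: affW.
Qed.

Lemma dderive_affine f v : affine_functions W f -> dderive f v = linear_part f.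
Proof.
move=> [t [alpha Wa ->]]; rewrite (linear_part_affine W_dual)//.
have -> : cst t = t *: (1 : V -> R^o) by apply/funext => w; rewrite !fctE [RHS]mulr1.
rewrite (dderive_lin W_dual W_submod); last exact: generated_gen.
  by rewrite dderive_cst scaler0 add0r (dderive_functional W_dual).
exact: generated_one.
Qed.

(** On affine functions the Poisson bracket is the given Lie bracket, since the
    differential of an affine function is its linear part; this is how the Jacobi
    identity of the Poisson bracket is known on generators. *)
Lemma poisson_bracket_affine f g : affine_functions W f -> affine_functions W g ->
  pb f g = b f g.
Proof.
move=> af ag; have [Wf Wg] := (linear_part_closed W_dual af, linear_part_closed W_dual ag).
apply/funext => v; rewrite /poisson_bracket !dderive_affine//.
by rewrite (affine_bracket_dual _ _ W_dual).
Qed.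

Lemma jacobiator_dual alpha beta gamma : W alpha -> W beta -> W gamma ->
  jacobiator pb alpha beta gamma = 0.
Proof.
move=> Wa Wb Wc.
have [Aa Ab Ac] := And3 (affW Wa) (affW Wb) (affW Wc).
rewrite /jacobiator !poisson_bracket_affine//; do ?exact: (lie_closed b_lie).
exact: (lie_jacobi b_lie).
Qed.

Lemma poisson_bracket_lie : lie_bracket_on A pb.
Proof.
split=> [F G||F AF|]; first exact: poisson_bracket_closed.
- split=> F AF; first by have [] := poisson_derivation AF.
  by have [] := biderivation_l poisson_bracket_skew poisson_derivation AF.
- apply/funext => v; rewrite /poisson_bracket.
  by rewrite (lie_alternating b_lie)//; apply: affW; exact: DW.
- apply: (jacobiator_vanish poisson_bracket_skew poisson_derivation poisson_bracket_closed).
  exact: jacobiator_dual.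
Qed.

Hypotheses (hV : hausdorff_space V) (W_separating : separating W)
  (Lambda_sharp : forall alpha, W alpha -> exists alpha_sharp : V,
      forall beta, W beta -> Lambda beta alpha = beta alpha_sharp)
  (br0_adjoint : forall alpha, W alpha ->
      exists2 ad_star : V -> V, continuous ad_star &
        forall beta v, W beta -> beta (ad_star v) = br0 alpha beta v).

(** A generator [beta] has the affine vector field
    [X(m) = beta^sharp - ad_0^* beta (m)], and
    [X_(FG) = G X_F + F X_G] is forced by the Leibniz rule. The defining equation
    is required for all [alpha] in [W] in place of the differentials of the
    functions at [m]. *)
Lemma hamiltonian_vector_field H : A H ->
  exists2 X : V -> V, poly_map (fun x _ => X x) &
    forall m alpha, W alpha -> alpha (X m) = b alpha (dderive H m) m.
Proof.
have lin alpha : W alpha -> linear alpha by move=> /W_dual[].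
move: H; apply: generated_subalgebra_ind.
- exists (fun=> 0) => [|m alpha Wa]; first exact: poly_cst.
  rewrite (dderive_cst 1) (linear_on0 W_submod (affine_bracket_linear Wa)).
  exact: (dual0 W_dual Wa).
- move=> beta Wb; have [w wE] := Lambda_sharp Wb; have [ad cad adE] := br0_adjoint Wb.
  (* ad is linear because W separates points and each br0 beta alpha is linear *)
  have linad : linear ad.
    move=> a x y; apply/eqP; rewrite -subr_eq0; apply/eqP/W_separating => alpha Wa.
    rewrite [X in alpha X]addrC -scaleN1r (lin _ Wa) (lin _ Wa) !adE//.
    have /lin -> : W (br0 beta alpha) by exact: (lie_closed br0_lie).
    by rewrite scaleN1r addNr.
  exists (fun m => (-1 : R^o) *: ad m + w) => [|m alpha Wa].
    apply: poly_add; last exact: poly_cst.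
    by apply: poly_scale; [exact: poly_cst | exact: poly_point].
  rewrite (dderive_functional W_dual)// (lin _ Wa) adE// -wE//.
  rewrite (affine_bracket_skew W_dual W_submod Lambda_skew br0_lie); do ?exact: affW.
  rewrite (affine_bracket_dual _ _ W_dual)// [Lambda alpha _]Lambda_skew//.
  by rewrite !fctE scaleN1r opprD addrC.
- move=> a F G AF AG [X pX XE] [Y pY YE].
  exists (fun m => (a : R^o) *: X m + Y m) => [|m alpha Wa].
    by apply: poly_add pY; apply: poly_scale pX; exact: poly_cst.
  rewrite (lin _ Wa) XE// YE// (dderive_lin W_dual W_submod)//.
  by rewrite (affine_bracket_linear Wa); do ?exact: DW.
- move=> F G AF AG [X pX XE] [Y pY YE].
  exists (fun m => G m *: X m + F m *: Y m) => [|m alpha Wa].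
    by apply: poly_add; apply: poly_scale => //; exact: (generated_poly_map W_dual).
  have WF := DW m AF; have WG := DW m AG.
  rewrite (dderive_mul W_dual W_submod)// (affine_bracket_linear Wa)//; last first.
    exact: submod_setZ.
  rewrite (linear_onZ W_submod (affine_bracket_linear Wa))//.
  rewrite (lin _ Wa) XE// -[F m *: Y m]addr0 (lin _ Wa) (dual0 W_dual Wa) YE//.
  by rewrite addr0.
Qed.

Lemma poisson_bracket_weak_poisson : weak_poisson A pb.
Proof.
split.
- move=> F AF; apply: poly_map_smooth; first exact: hausdorff_regular.
  exact: (generated_poly_map W_dual).
- exact: generated_subalgebra_closed.
- exact: poisson_bracket_lie.
- by move=> F G H AF; have [_] := poisson_derivation AF; exact.
- move=> m v D0; apply: W_separating => alpha Wa.
  by have := D0 alpha (generated_gen Wa); rewrite (dderive_functional W_dual).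
- move=> H /hamiltonian_vector_field[X pX XE].
  by exists X => [|F AF m]; [exact: poly_map_smooth | rewrite XE//; exact: DW].
Qed.

End PoissonBracket.

Theorem theorem2p8 (R : realType) (V : tvsType R) (hV : hausdorff_space V)
    (Vstar : set (V -> R^o))
    (Vstar_dual : Vstar `<=` topological_dual V)
    (Vstar_subspace : submod_closed (mem Vstar))
    (Vstar_separating : separating Vstar)
    (Lambda : (V -> R^o) -> (V -> R^o) -> R^o)
    (Lambda_bilinear : bilinear_on Vstar Lambda)
    (Lambda_skew : forall alpha beta, Vstar alpha -> Vstar beta ->
      Lambda alpha beta = - Lambda beta alpha)
    (Lambda_sharp : forall alpha, Vstar alpha ->
      exists alpha_sharp : V, forall beta, Vstar beta ->
        Lambda beta alpha = beta alpha_sharp)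
    (br0 : (V -> R^o) -> (V -> R^o) -> (V -> R^o))
    (br0_lie : lie_bracket_on Vstar br0)
    (Lambda_cocycle : forall alpha beta gamma,
      Vstar alpha -> Vstar beta -> Vstar gamma ->
      Lambda (br0 alpha beta) gamma + Lambda (br0 beta gamma) alpha
        + Lambda (br0 gamma alpha) beta = 0)
    (br0_adjoint : forall alpha, Vstar alpha ->
      exists2 ad_star : V -> V, continuous ad_star &
        forall beta v, Vstar beta -> beta (ad_star v) = br0 alpha beta v) :
  let A := generated_subalgebra Vstar in
  [/\ lie_bracket_on (affine_functions Vstar) (affine_bracket Lambda br0),
      forall (t s : R) alpha beta, Vstar alpha -> Vstar beta ->
        affine_bracket Lambda br0 (cst t + alpha) (cst s + beta)
        = cst (Lambda alpha beta) + br0 alpha beta,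
      is_symmetric_algebra Vstar A,
      forall F, A F -> forall v, Vstar (dderive F v) &
      weak_poisson A (poisson_bracket Lambda br0)].
Proof.
split.
- exact: affine_bracket_lie.
- move=> t s alpha beta Wa Wb.
  by rewrite (affine_bracketE _ _ Vstar_dual)// (affine_bracket_dual _ _ Vstar_dual).
- by apply: symmetric_algebra_generated => // alpha /Vstar_dual[].
- by move=> F AF v; exact: dderive_generated.
- exact: poisson_bracket_weak_poisson.
Qed.
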